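(* Let $X$ be a metric space and let $n\ge 0$ be an integer. If $X$ is of asymptotic dimension at most $n$, then for every $\epsilon>0$ there is $\delta>0$ such that the following holds: for every simplicial complex $K$, every subset $A\subset X$, every $\delta$-partition of unity $f\colon X\to K$ and every function $g\colon A\to K^{(n)}$ such that $f|_A=i\circ g$, where $i\colon K^{(n)}\to K$ is the inclusion, there is a filler $h\colon X\to K^{(n)}$ that is an $\epsilon$-partition of unity. Here $h$ being a filler means that $h|_A=g$ and that, for every $x\in X$ and every simplex $\Delta$ of $K$, $f(x)\in\Delta$ implies $h(x)\in\Delta$.
   Context: A family of subsets of a metric space is uniformly bounded if the diameters of its elements have a finite common upper bound. Asymptotic dimension. $X$ has asymptotic dimension at most $n$ if for every uniformly bounded cover $\mathcal{U}$ of $X$ there is a uniformly bounded cover $\mathcal{V}$ of $X$ such that every element $U$ of $\mathcal{U}$ intersects at most $n+1$ elements of $\mathcal{V}$. Simplicial complexes. For a set $S$, the full complex $\Delta(S)$ is the set of finitely supported functions $f\colon S\to[0,1]$ with $\sum_{s\in S}f(s)=1$, with the metric inherited from $l^1(S)$. A simplicial complex $K$ is a subcomplex of some $\Delta(S)$, with the induced $l^1$-metric; $K^{(0)}$ is its set of vertices and $K^{(n)}$ its $n$-skeleton. The star $st(v)$ of a vertex $v$ is the set of all $f\in K$ with $f(v)>0$. $\delta$-partitions of unity. A function $f$ between metric spaces is $(\lambda,C)$-Lipschitz if $d(f(x),f(y))\le\lambda d(x,y)+C$ for all $x,y$. For $\delta>0$, a function $f\colon X\to K$ is a $\delta$-partition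 of unity if it is $(\delta,\delta)$-Lipschitz, the cover $\mathcal{V}:=\{f^{-1}(st(v))\}_{v\in K^{(0)}}$ of $X$ is uniformly bounded, and the Lebesgue number of $\mathcal{V}$ is at least $\frac1\delta$ (a cover has Lebesgue number at least $r$ if every subset of $X$ of diameter less than $r$ is contained in some element of the cover). *)

(* Defs.v *)
From HB Require Import structures.
From mathcomp Require Export all_boot all_order all_algebra.
From mathcomp Require Export all_classical all_reals all_analysis.

Set Implicit Arguments.
Unset Strict Implicit.
Unset Printing Implicit Defensive.
Import Order.TTheory GRing.Theory Num.Theory.

Local Open Scope classical_set_scope.
Local Open Scope card_scope.
Local Open Scope ring_scope.

Section MetricSpaces.
Context {R : realType} {X : metricType R}.

(* The added 0 makes the diameter of the empty set 0 instead of -oo. *)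
Definition diam (B : set X) : \bar R :=
  ereal_sup (0%E |` [set (mdist z.1 z.2)%:E | z in B `*` B]).

Definition uniformly_bounded (UU : set (set X)) : Prop :=
  exists M : R, forall U, UU U -> (diam U <= M%:E)%E.

Definition is_cover (UU : set (set X)) : Prop :=
  \bigcup_(U in UU) U = [set: X].

Definition lebesgue_number_ge (r : R) (VV : set (set X)) : Prop :=
  forall B : set X, (diam B < r%:E)%E -> exists2 V, VV V & B `<=` V.

End MetricSpaces.

Definition asdim_le (R : realType) (X : metricType R) (n : nat) : Prop :=
  forall UU : set (set X), is_cover UU -> uniformly_bounded UU ->
  exists VV : set (set X), [/\ is_cover VV, uniformly_bounded VV &
    forall U, UU U -> [set V | VV V /\ U `&` V !=set0] #<= `I_n.+1].

(* Sets of functions S -> R serve as subsets of Delta(S); all the sums over S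
   below have only finitely many nonzero terms on Delta(S). *)
Section SimplicialComplexes.
Context {R : realType} {S : choiceType}.
Implicit Types (K D : set (S -> R)) (f g : S -> R) (F : set S).

Definition supp f : set S := [set s | f s != 0].

Definition full_complex : set (S -> R) :=
  [set f | [/\ finite_set (supp f), forall s, 0 <= f s <= 1 &
              \sum_(s \in [set: S]) f s = 1]].

Definition l1_dist f g : R := \sum_(s \in [set: S]) `|f s - g s|.

(* The closed simplex of Delta(S) spanned by F. *)
Definition simplex F : set (S -> R) :=
  [set f | full_complex f /\ supp f `<=` F].

(* A subcomplex of Delta(S) is a union of closed simplices. *)
Definition is_simplicial_complex K : Prop :=
  exists FF : set (set S),
    (forall F, FF F -> finite_set F /\ F !=set0) /\
    K = \bigcup_(F in FF) simplex F.

Definition simplex_of K D : Prop :=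
  exists F, [/\ finite_set F, F !=set0, D = simplex F & D `<=` K].

(* A vertex is identified with the element v of S such that the indicator
   function of v belongs to K. *)
Definition vertices K : set S := [set v | K (fun s => (s == v)%:R)].

Definition skeleton (n : nat) K : set (S -> R) :=
  \bigcup_(F in [set F | [/\ F !=set0, F #<= `I_n.+1 & simplex F `<=` K]])
    simplex F.

Definition star K (v : S) : set (S -> R) := [set f | K f /\ 0 < f v].

End SimplicialComplexes.

Section PartitionsOfUnity.
Context {R : realType} {X : metricType R} {S : choiceType}.
Implicit Types (K : set (S -> R)) (f : X -> S -> R).

Definition quasi_lipschitz (lambda C : R) f : Prop :=
  forall x y, l1_dist (f x) (f y) <= lambda * mdist x y + C.

Definition star_cover K f : set (set X) :=
  [set f @^-1` star K v | v in vertices K].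

(* For f mapping X to a simplicial complex K, star_cover K f always covers X,
   as any point of K has a positive coordinate. *)
Definition partition_of_unity (delta : R) K f : Prop :=
  [/\ set_fun [set: X] K f, quasi_lipschitz delta delta f,
      uniformly_bounded (star_cover K f) &
      lebesgue_number_ge (1 / delta) (star_cover K f)].

(* Only the values of g on A are relevant. *)
Definition filler K (A : set X) f (g h : X -> S -> R) : Prop :=
  (forall x, A x -> h x = g x) /\
  (forall x D, simplex_of K D -> D (f x) -> D (h x)).

End PartitionsOfUnity.

(* Main.v *)
Require Import Defs.
From mathcomp Require Import lra ring.

Set Implicit Arguments.
Unset Strict Implicit.
Unset Printing Implicit Defensive.
Import Order.TTheory GRing.Theory Num.Theory.

Local Open Scope classical_set_scope.
Local Open Scope card_scope.
Local Open Scope ring_scope.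

(** If [A] is empty, the map [h] comes from a cover alone: a cover of [X] of
    multiplicity n + 1 and large Lebesgue number has a slowly varying partition
    of unity [p] with values in the n-skeleton of the full complex on its
    elements ([asdim_partition_of_unity]).  Once 1/delta exceeds the diameters
    of the sets where the coordinates [p ^~ V] are positive, each such set lies
    in some [f @^-1` star K v], and sending [V] to [v] turns [p] into a map
    [psi] with values in the n-skeleton of [K] whose carriers are inside those
    of [f].

    In general [h] has to equal [f] on [A], where [f] takes values in the
    n-skeleton, without leaving the n-skeleton in the transition region.  Let
    [c x] be the defect of [f x], the mass left by its best n + 1
    coordinates.  It varies as slowly as [f], and it vanishes on [A].  Put
      [q x s = max 0 (f x s - 2 * c x)],
      [h x = q x + (1 - sum of q x) psi x].
    On [A] one has [q = f], of total mass 1, hence [h = f].  The point is that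
    the transition does not raise the dimension.  At most n + 1 coordinates of
    [f x] exceed [c x] ([card_gt_defect]); these include the support of [q x].
    If [q x] is nonzero, then some coordinate of [f x] exceeds [c x] by a margin
    depending only on [n] ([dominant_coord]); since [f] varies slowly, that
    coordinate still exceeds [c] on any set of the given size around [x], and it
    can be taken as the vertex [v] assigned to the sets [V] through [x]
    ([exists_dominant_vertex]).  So where [q x] is nonzero, all vertices
    used by [psi x] are among the same n + 1 coordinates; where [q x] is zero,
    [h x = psi x].

    Finally [h x (v V) > 0] whenever [p x V > 0]: either [q x] has mass less
    than 1, or its mass is 1, so [c x = 0] and [h x = f x].  Therefore the star
    cover of [h] is refined by that of [p] and inherits its Lebesgue number. *)

(** * Sums of finitely supported functions *)

Section FiniteSums.
Context {R : realType} {S : choiceType}.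
Implicit Types (D F : set S) (f g : S -> R).

Lemma fsumTE D f : (forall s, ~ D s -> f s = 0) ->
  \sum_(s \in [set: S]) f s = \sum_(s \in D) f s.
Proof. by move=> f0; apply/esym/fsbig_widen => // s [_ /f0]. Qed.

Lemma ler_fsum D f g : finite_set D -> (forall s, D s -> f s <= g s) ->
  \sum_(s \in D) f s <= \sum_(s \in D) g s.
Proof.
move=> finD fg; rewrite !fsbig_finite// big_seq [leRHS]big_seq.
by apply: ler_sum => s; rewrite in_fset_set// inE => /fg.
Qed.

Lemma fsumrD D f g : finite_set D ->
  \sum_(s \in D) (f s + g s) = \sum_(s \in D) f s + \sum_(s \in D) g s.
Proof. by move=> finD; rewrite fsbig_split. Qed.

Lemma fsumrB D f g : finite_set D ->
  \sum_(s \in D) (f s - g s) = \sum_(s \in D) f s - \sum_(s \in D) g s.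
Proof. by move=> finD; rewrite !fsbig_finite// sumrB. Qed.

Lemma ler_norm_fsum D f : finite_set D ->
  `|\sum_(s \in D) f s| <= \sum_(s \in D) `|f s|.
Proof. by move=> finD; rewrite !fsbig_finite// ler_norm_sum. Qed.

Lemma ler_fsum_subset F D f : finite_set D -> F `<=` D ->
  (forall s, 0 <= f s) -> \sum_(s \in F) f s <= \sum_(s \in D) f s.
Proof.
move=> finD FD f0; rewrite (fsbigID F D)//.
rewrite (_ : D `&` F = F) ?lerDl ?fsumr_ge0//.
by rewrite setIC; apply/setIidPl.
Qed.

Lemma fsum_cst_le F (k : nat) (c : R) : F #<= `I_k -> 0 <= c ->
  \sum_(s \in F) c <= k%:R * c.
Proof.
move=> Fk c0; have finF : finite_set F by apply/finite_set_leP; exists k.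
rewrite fsbig_finite// big_const_seq count_predT iter_addr_0 -[leLHS]mulr_natl.
by rewrite ler_wpM2r// ler_nat geq_card_fset_set.
Qed.

Lemma fsum_indic_le F D (k : nat) (c : R) : finite_set D -> F #<= `I_k ->
  0 <= c -> \sum_(s \in D) (if s \in F then c else 0) <= k%:R * c.
Proof.
move=> finD Fk c0; rewrite -fsbig_mkcondr.
apply: fsum_cst_le => //; apply: card_le_trans Fk.
by apply: subset_card_le => s [].
Qed.

Lemma notin_supp f s : ~ supp f s -> f s = 0.
Proof. by move/negP; rewrite negbK => /eqP. Qed.

Lemma l1_distE D f g : supp f `<=` D -> supp g `<=` D ->
  l1_dist f g = \sum_(s \in D) `|f s - g s|.
Proof.
move=> fD gD; apply: fsumTE => s Ds.
by rewrite !notin_supp ?subrr ?normr0// => [/gD|/fD].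
Qed.

Lemma l1_distC f g : l1_dist f g = l1_dist g f.
Proof. by apply: eq_fsbigr => s _; rewrite distrC. Qed.

Lemma l1_dist_ge0 f g : 0 <= l1_dist f g.
Proof. exact: fsumr_ge0. Qed.

Lemma l1_dist_ge_sum F f g : finite_set (supp f) -> finite_set (supp g) ->
  finite_set F -> `|\sum_(s \in F) f s - \sum_(s \in F) g s| <= l1_dist f g.
Proof.
move=> finf fing finF.
rewrite -fsumrB// (@l1_distE (F `|` (supp f `|` supp g))).
- apply: le_trans (ler_norm_fsum _ finF) _.
  by apply: ler_fsum_subset => //; rewrite !finite_setU.
- by move=> s sf; right; left.
- by move=> s sg; right; right.
Qed.

Lemma l1_dist_ge_sumT f g : finite_set (supp f) -> finite_set (supp g) ->
  `|\sum_(s \in [set: S]) f s - \sum_(s \in [set: S]) g s| <= l1_dist f g.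
Proof.
move=> finf fing.
have finD : finite_set (supp f `|` supp g) by rewrite finite_setU.
rewrite !(@fsumTE (supp f `|` supp g)) ?l1_dist_ge_sum// => s Ds.
- by apply/notin_supp => sg; apply: Ds; right.
- by apply/notin_supp => sf; apply: Ds; left.
Qed.

Lemma l1_dist_ge_coord f g s : finite_set (supp f) -> finite_set (supp g) ->
  `|f s - g s| <= l1_dist f g.
Proof. by move=> finf fing; have := l1_dist_ge_sum finf fing (finite_set1 s);
  rewrite !fsbig_set1. Qed.

Lemma full_complex_intro f : finite_set (supp f) -> (forall s, 0 <= f s) ->
  \sum_(s \in [set: S]) f s = 1 -> full_complex f.
Proof.
move=> finf f0 f1; split=> // s; rewrite f0/= -f1 (fsumTE (@notin_supp f)).
have [->|fs0] := eqVneq (f s) 0; first exact: fsumr_ge0.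
have := @ler_fsum_subset [set s] _ f finf; rewrite fsbig_set1.
by apply=> // _ ->.
Qed.

Lemma full_complex_pos f : full_complex f -> exists s, 0 < f s.
Proof.
move=> [_ _ f1]; have [|s _ fs] := @fsumr_gt0 R S [::] setT f.
  by rewrite f1.
by exists s.
Qed.

End FiniteSums.

(** * Trimming a point of the full complex towards a skeleton *)

Section Trimming.
Context {R : realType} {S : choiceType} (k : nat).
Implicit Types (F : set S) (f g : S -> R).

(** For [f] in the full complex and [k > 0], this is half the l1-distance from
    [f] to the points with at most [k] nonzero coordinates.  As an infimum over
    sets of coordinates it is visibly 1-Lipschitz, each of the sums being so. *)
Definition defect f : R :=
  inf [set 1 - \sum_(s \in F) f s | F in [set F | F #<= `I_k]].

Lemma le_defect f (m : R) :
  (forall F, F #<= `I_k -> m <= 1 - \sum_(s \in F) f s) -> m <= defect f.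
Proof.
move=> mf; apply: lb_le_inf; last by move=> _ [F Fk <-]; exact: mf.
by exists (1 - \sum_(s \in set0) f s), set0 => //; exact: card_ge0.
Qed.

Lemma sum_full_complex_le1 f F : full_complex f -> finite_set F ->
  \sum_(s \in F) f s <= 1.
Proof.
move=> [finf f01 f1] finF.
have f0 s : 0 <= f s by case/andP: (f01 s).
rewrite -f1 (@fsumTE _ _ (F `|` supp f)) => [|s Ds].
  by apply: ler_fsum_subset; rewrite ?finite_setU// => s; left.
by apply: notin_supp => sf; apply: Ds; right.
Qed.

Lemma defect_le f F : full_complex f -> F #<= `I_k ->
  defect f <= 1 - \sum_(s \in F) f s.
Proof.
move=> Df Fk; apply: ge_inf; last by exists F.
exists 0 => _ [G Gk <-]; rewrite subr_ge0.
by apply: sum_full_complex_le1 => //; apply/finite_set_leP; exists k.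
Qed.

Lemma defect_ge0 f : full_complex f -> 0 <= defect f.
Proof.
move=> Df; apply: le_defect => F Fk; rewrite subr_ge0.
by apply: sum_full_complex_le1 => //; apply/finite_set_leP; exists k.
Qed.

Lemma defect_skeleton f : full_complex f -> supp f #<= `I_k -> defect f = 0.
Proof.
move=> Df fk; apply/le_anti; rewrite defect_ge0// andbT.
apply: le_trans (defect_le Df fk) _; case: Df => _ _ <-.
by rewrite (fsumTE (@notin_supp _ _ f)) subrr.
Qed.

Lemma defect_le_l1 f g : full_complex f -> full_complex g ->
  defect f <= defect g + l1_dist f g.
Proof.
move=> Df Dg; rewrite -lerBlDr; apply: le_defect => F Fk.
have finF : finite_set F by apply/finite_set_leP; exists k.
have [[finf _ _] [fing _ _]] := (Df, Dg).
have := l1_dist_ge_sum finf fing finF; rewrite ler_norml => /andP[fg _].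
by have := defect_le Df Fk; lra.
Qed.

Lemma defect_lipschitz f g : full_complex f -> full_complex g ->
  `|defect f - defect g| <= l1_dist f g.
Proof.
move=> Df Dg; have := defect_le_l1 Df Dg; have := defect_le_l1 Dg Df.
by rewrite (l1_distC g) ler_norml => ? ?; apply/andP; split; lra.
Qed.

(** A set of [k] coordinates omitting [s] leaves out at least the mass [f s].
    Hence a set whose remaining mass is smaller than all the coordinates that
    exceed the defect contains all of them. *)
Lemma card_gt_defect f : full_complex f ->
  [set s | defect f < f s] #<= `I_k.
Proof.
move=> Df; have [finf f01 _] := Df; set G := [set s | _].
have GS : G `<=` supp f.
  by move=> s Gs; apply: lt0r_neq0; apply: le_lt_trans (defect_ge0 Df) Gs.
have finG : finite_set G := sub_finite_set GS finf.
(* The least coordinate in G; the default value keeps it above the defect when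
   G is empty. *)
pose m := \big[Num.min/defect f + 1]_(s <- finmap.enum_fset (fset_set G)) f s.
have mG s : G s -> m <= f s.
  by move=> Gs; rewrite /m; apply: ge_bigmin_seq; rewrite ?in_fset_set ?inE.
have dm : defect f < m.
  rewrite /m big_seq_cond; apply: lt_bigmin; first by rewrite ltrDl.
  by move=> s /andP[]; rewrite in_fset_set ?inE.
have [||_ [F Fk <-] Fm] := @inf_lt _
  [set 1 - \sum_(s \in F) f s | F in [set F | F #<= `I_k]] m.
- by exists (1 - \sum_(s \in set0) f s), set0 => //; exact: card_ge0.
- exact: dm.
have finF : finite_set F by apply/finite_set_leP; exists k.
apply: card_le_trans Fk; apply: subset_card_le => s Gs.
apply: contrapT => Fs.
have := @sum_full_complex_le1 f (s |` F) Df.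
rewrite fsbigU0 ?finite_setU//; last by move=> t [-> ].
rewrite fsbig_set1 /= => /(_ (conj (finite_set1 s) finF)).
by have := mG _ Gs; lra.
Qed.

(** If the defect is small, the largest coordinate is about 1/k at least, so the
    margin is clear; if it is not, a coordinate larger than twice the defect
    exceeds it by as much as the defect itself.  The constant balances the two
    cases: were every coordinate at most defect + c, then defect < c by
    assumption and 1 <= defect + k (defect + c) < (2 k + 1) c. *)
Lemma dominant_coord f s : full_complex f -> 2 * defect f < f s ->
  exists t, defect f + (2 * k%:R + 1)^-1 < f t.
Proof.
move=> Df fs; apply/not_existsP => noT.
have {}noT t : f t <= defect f + (2 * k%:R + 1)^-1 by rewrite leNgt; apply/negP.
set c := _^-1 in noT.
have k0 : 0 <= k%:R :> R by [].
have cE : c * (2 * k%:R + 1) = 1 by rewrite mulVf// gt_eqF// ltr_wpDl ?mulr_ge0.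
have c0 : 0 < c by rewrite invr_gt0 ltr_wpDl ?mulr_ge0.
have d0 := defect_ge0 Df.
have : 1 - k%:R * (defect f + c) <= defect f.
  apply: le_defect => F Fk; rewrite lerD2l lerN2.
  have finF : finite_set F by apply/finite_set_leP; exists k.
  apply: le_trans (fsum_cst_le Fk _); last by rewrite addr_ge0// ltW.
  exact: ler_fsum.
have dc : defect f < c by have := noT s; lra.
have : k%:R * defect f <= k%:R * c by rewrite ler_wpM2l// ltW.
by nra.
Qed.

(** Subtracting the defect once would already leave at most [k] nonzero
    coordinates; subtracting it twice makes every nonzero value come with the
    uniform margin of [dominant_coord]. *)
Definition trim f : S -> R := fun s => Num.max 0 (f s - 2 * defect f).

Lemma trim_ge0 f s : 0 <= trim f s.
Proof. by rewrite le_max lexx. Qed.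

Lemma trim_le f s : full_complex f -> trim f s <= f s.
Proof.
move=> Df; have := defect_ge0 Df; have [_ /(_ s)/andP[f0 _] _] := Df.
by rewrite ge_max f0/= => d0; lra.
Qed.

Lemma supp_trim f : supp (trim f) `<=` [set s | 2 * defect f < f s].
Proof.
move=> s /=; apply: contraNP => /negP; rewrite -leNgt -subr_le0.
by rewrite /trim => /max_idPl ->.
Qed.

Lemma supp_trim_sub f : full_complex f -> supp (trim f) `<=` supp f.
Proof.
move=> Df s /supp_trim/= fs; apply: lt0r_neq0; apply: le_lt_trans fs.
by rewrite mulr_ge0// defect_ge0.
Qed.

Lemma trim_id f : full_complex f -> defect f = 0 -> trim f = f.
Proof.
move=> [_ f01 _] f0; apply/funext => s; rewrite /trim f0 mulr0 subr0.
by apply/max_idPr; case/andP: (f01 s).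
Qed.

Lemma sum_trimE f : full_complex f ->
  \sum_(s \in [set: S]) trim f s = \sum_(s \in supp f) trim f s.
Proof.
by move=> Df; apply: fsumTE => s fs; apply: notin_supp => /(supp_trim_sub Df).
Qed.

Lemma sum_trim_le1 f : full_complex f -> \sum_(s \in [set: S]) trim f s <= 1.
Proof.
move=> Df; have [finf _ f1] := Df; rewrite sum_trimE// -f1.
rewrite (fsumTE (@notin_supp _ _ f)).
by apply: ler_fsum => // s _; exact: trim_le.
Qed.

Lemma sum_trim_eq1 f : full_complex f ->
  \sum_(s \in [set: S]) trim f s = 1 -> defect f = 0.
Proof.
move=> Df; have [finf _ f1] := Df.
have [s fs] := full_complex_pos Df.
rewrite sum_trimE// -f1 (fsumTE (@notin_supp _ _ f)) => /esym/eqP.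
rewrite -subr_eq0 -fsumrB// => /eqP/pfsumr_eq0 => /(_ finf) H.
have : f s - trim f s = 0.
  apply: H; last exact: lt0r_neq0.
  by move=> t _; rewrite subr_ge0 trim_le.
have := defect_ge0 Df; rewrite /trim.
by case: (leP 0 (f s - 2 * defect f)) => ? ? ?; lra.
Qed.

(** The defect only enters the coordinates that exceed it, at most [k] for each
    of [f] and [g], which keeps the Lipschitz constant independent of the sizes
    of the supports. *)
Lemma l1_dist_trim f g : full_complex f -> full_complex g ->
  l1_dist (trim f) (trim g) <= (4 * k%:R + 1) * l1_dist f g.
Proof.
move=> Df Dg; have [[finf _ _] [fing _ _]] := (Df, Dg).
set D := supp f `|` supp g.
have finD : finite_set D by rewrite finite_setU.
have fD : supp f `<=` D by left.
have gD : supp g `<=` D by right.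
rewrite (@l1_distE _ _ D); last 2 first.
- by move=> s /(supp_trim_sub Df)/fD.
- by move=> s /(supp_trim_sub Dg)/gD.
set l := l1_dist f g.
have l0 : 0 <= l := l1_dist_ge0 f g.
(* The cost at s of changing 2 * defect by at most 2 * l. *)
pose i f s : R := if s \in [set s | defect f < f s] then 2 * l else 0.
have iE h s : i h s = if defect h < h s then 2 * l else 0.
  by rewrite /i (_ : s \in _ = (defect h < h s))//; apply/idP/idP; rewrite inE.
have le_i s : `|trim f s - trim g s| <= `|f s - g s| + (i f s + i g s).
  have := defect_lipschitz Df Dg; rewrite -/l ler_norml => /andP[dl dr].
  have [df dg] := (defect_ge0 Df, defect_ge0 Dg).
  have abs1 := ler_norm (f s - g s).
  have abs2 := ler_norm (g s - f s); rewrite distrC in abs2.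
  rewrite !iE /trim ler_norml.
  case: (leP 0 (f s - _)) => hf; case: (leP 0 (g s - _)) => hg;
    case: (ltP (defect f) (f s)) => ?; case: (ltP (defect g) (g s)) => ?;
    by apply/andP; split; lra.
apply: (@le_trans _ _ (\sum_(s \in D) (`|f s - g s| + (i f s + i g s)))).
  exact: ler_fsum.
rewrite !fsumrD// -l1_distE// -/l.
have l2 : 0 <= 2 * l by rewrite mulr_ge0.
have : \sum_(s \in D) i f s <= k%:R * (2 * l).
  exact: fsum_indic_le (card_gt_defect Df) l2.
have : \sum_(s \in D) i g s <= k%:R * (2 * l).
  exact: fsum_indic_le (card_gt_defect Dg) l2.
by lra.
Qed.

End Trimming.

(** * Simplicial maps and blending *)

Section SimplicialMap.
Context {R : realType} {T S : choiceType} (v : T -> S).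
Implicit Types (p q : T -> R).

Definition simplicial_map p : S -> R :=
  fun s => \sum_(t \in v @^-1` [set s]) p t.

Lemma supp_simplicial_map p : supp (simplicial_map p) `<=` v @` supp p.
Proof.
move=> s; apply: contraPP => vs; apply/negP; rewrite negbK; apply/eqP.
by apply: fsbig1 => t /= vt; apply: notin_supp => pt; apply: vs; exists t.
Qed.

Lemma finite_supp_simplicial_map p :
  finite_set (supp p) -> finite_set (supp (simplicial_map p)).
Proof.
move=> finp; apply: sub_finite_set (@supp_simplicial_map p) _.
exact: finite_image.
Qed.

Lemma simplicial_mapE p (D : set T) s : supp p `<=` D ->
  simplicial_map p s = \sum_(t \in D) (if v t == s then p t else 0).
Proof.
move=> pD; rewrite /simplicial_map fsbig_mkcond.
rewrite -(@fsumTE _ _ D) => [|t Dt]; last first.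
  by rewrite (@notin_supp _ _ p) ?if_same// => /pD.
apply: eq_fsbigr => t _; rewrite patchE.
by case: eqP => vt; [rewrite mem_set|rewrite memNset].
Qed.

Lemma fsum_fiber (D : set T) p : finite_set D ->
  \sum_(s \in v @` D) \sum_(t \in D) (if v t == s then p t else 0) =
  \sum_(t \in D) p t.
Proof.
move=> finD; rewrite exchange_fsbig//; last exact: finite_image.
apply: eq_fsbigr => t; rewrite inE => Dt.
rewrite -(@fsbig_widen _ _ _ _ [set v t]) ?fsbig_set1 ?eqxx//.
  by move=> _ ->; exists t.
by move=> s [_ /=]; rewrite eq_sym; case: eqP.
Qed.

Lemma simplicial_map_full_complex p :
  full_complex p -> full_complex (simplicial_map p).
Proof.
move=> [finp p01 p1]; apply: full_complex_intro.
- exact: finite_supp_simplicial_map.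
- by move=> s; apply: fsumr_ge0 => t _; case/andP: (p01 t).
- rewrite (@fsumTE _ _ (v @` supp p)) => [|s vs].
    rewrite -p1 (fsumTE (@notin_supp _ _ p)) -(fsum_fiber _ finp).
    by apply: eq_fsbigr => s _; rewrite (@simplicial_mapE _ (supp p)).
  by apply: notin_supp => /supp_simplicial_map.
Qed.

Lemma l1_dist_simplicial_map p q : finite_set (supp p) -> finite_set (supp q) ->
  l1_dist (simplicial_map p) (simplicial_map q) <= l1_dist p q.
Proof.
move=> finp finq; set D := supp p `|` supp q.
have finD : finite_set D by rewrite finite_setU.
have pD : supp p `<=` D by left.
have qD : supp q `<=` D by right.
have finvD : finite_set (v @` D) by exact: finite_image.
rewrite (@l1_distE _ _ (v @` D)); last 2 first.
- by apply: subset_trans (@supp_simplicial_map p) _; exact: image_subset.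
- by apply: subset_trans (@supp_simplicial_map q) _; exact: image_subset.
rewrite (@l1_distE _ _ D)// -(fsum_fiber _ finD).
apply: ler_fsum => // s _; rewrite !(@simplicial_mapE _ D)// -fsumrB//.
apply: le_trans (ler_norm_fsum _ finD) _; apply: ler_fsum => // t _.
by case: ifP => // _; rewrite subrr normr0.
Qed.

Lemma simplicial_map_gt0 p t : full_complex p -> 0 < p t ->
  0 < simplicial_map p (v t).
Proof.
move=> [finp p01 _] pt; rewrite (@simplicial_mapE _ (supp p))//.
have p0 u : 0 <= p u by case/andP: (p01 u).
apply: lt_le_trans pt _.
have := @ler_fsum_subset _ _ [set t] (supp p)
  (fun u => if v u == v t then p u else 0) finp.
rewrite fsbig_set1 eqxx; have [->|pt0] := eqVneq (p t) 0.
  by move=> _; apply: fsumr_ge0 => u _; case: ifP.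
by apply=> [_ -> //|u]; case: ifP.
Qed.

End SimplicialMap.

Section Blend.
Context {R : realType} {S : choiceType}.
Implicit Types (q p : S -> R).

Definition blend q p : S -> R :=
  fun s => q s + (1 - \sum_(t \in [set: S]) q t) * p s.

Lemma supp_blend q p : supp (blend q p) `<=` supp q `|` supp p.
Proof.
move=> s; apply: contraPP => /not_orP[qs ps]; apply/negP; rewrite negbK.
by rewrite /blend (notin_supp qs) (notin_supp ps) mulr0 addr0.
Qed.

Lemma blend_full_complex q p : finite_set (supp q) -> (forall s, 0 <= q s) ->
  \sum_(s \in [set: S]) q s <= 1 -> full_complex p -> full_complex (blend q p).
Proof.
move=> finq q0 q1 [finp p01 p1]; set D := supp q `|` supp p.
have finD : finite_set D by rewrite finite_setU.
apply: full_complex_intro.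
- exact: sub_finite_set (@supp_blend q p) _.
- move=> s; rewrite addr_ge0// mulr_ge0 ?subr_ge0//.
  by case/andP: (p01 s).
rewrite (@fsumTE _ _ D) => [|s Ds]; last first.
  by apply: notin_supp => /supp_blend.
rewrite fsumrD// -mulr_fsumr -(@fsumTE _ _ D) => [|s Ds].
  rewrite -(@fsumTE _ _ D) ?p1 ?mulr1 ?subrKC// => s Ds.
  by apply: notin_supp => ps; apply: Ds; right.
by apply: notin_supp => qs; apply: Ds; left.
Qed.

(** The two weights [1 - sum q] and [1 - sum q'] differ by at most
    [l1_dist q q'], which accounts for the factor 2. *)
Lemma l1_dist_blend q q' p p' : finite_set (supp q) -> finite_set (supp q') ->
  (forall s, 0 <= q s) -> \sum_(s \in [set: S]) q s <= 1 ->
  full_complex p -> full_complex p' ->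
  l1_dist (blend q p) (blend q' p') <= 2 * l1_dist q q' + l1_dist p p'.
Proof.
move=> finq finq' q0 q1 Dp Dp'; have [[finp _ _] [finp' p'01 p'1]] := (Dp, Dp').
have Q0 : 0 <= \sum_(s \in [set: S]) q s by exact: fsumr_ge0.
have := l1_dist_ge_sumT finq finq'.
set Q := \sum_(s \in [set: S]) q s in q1 Q0 *.
set Q' := \sum_(s \in [set: S]) q' s => QQ'.
set D := (supp q `|` supp p) `|` (supp q' `|` supp p').
have finD : finite_set D by rewrite !finite_setU.
rewrite (@l1_distE _ _ D); last 2 first.
- by move=> s /supp_blend ?; left.
- by move=> s /supp_blend ?; right.
apply: (@le_trans _ _ (\sum_(s \in D) ((`|q s - q' s| + `|p s - p' s|) +
    `|Q - Q'| * p' s))).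
  apply: ler_fsum => // s _.
  have -> : blend q p s - blend q' p' s =
    (q s - q' s) + (1 - Q) * (p s - p' s) - (Q - Q') * p' s.
    by rewrite /blend -/Q -/Q'; ring.
  have p'0 : 0 <= p' s by case/andP: (p'01 s).
  apply: le_trans (ler_normB _ _) _; rewrite normrM (ger0_norm p'0) lerD2r.
  apply: le_trans (ler_normD _ _) _; rewrite lerD2l normrM.
  rewrite ger0_norm ?subr_ge0//.
  by rewrite ler_piMl// gerBl.
rewrite !fsumrD// -mulr_fsumr -!l1_distE//.
- rewrite -(@fsumTE _ _ D) ?p'1 => [|s Ds].
    by lra.
  by apply: notin_supp => ps; apply: Ds; right; right.
- by move=> s ?; left; right.
- by move=> s ?; right; right.
- by move=> s ?; left; left.
- by move=> s ?; right; left.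
Qed.

End Blend.

(** * The nerve of a cover of finite multiplicity *)

Section Diameter.
Context {R : realType} {X : metricType R}.
Implicit Types (A B : set X).

Lemma mdist_le_diam B x y : B x -> B y -> ((mdist x y)%:E <= diam B)%E.
Proof. by move=> Bx By; apply: ereal_sup_ubound; right; exists (x, y). Qed.

Lemma diam_le B (M : R) : 0 <= M ->
  (forall x y, B x -> B y -> mdist x y <= M) -> (diam B <= M%:E)%E.
Proof.
move=> M0 BM; apply: ge_ereal_sup => _ [->|[[x y] [/= Bx By] <-]].
  by rewrite lee_fin.
by rewrite lee_fin; exact: BM.
Qed.

Lemma diam_subset A B : A `<=` B -> (diam A <= diam B)%E.
Proof.
move=> AB; apply: le_ereal_sup => _ [->|[[x y] [/= Ax Ay] <-]]; first by left.
by right; exists (x, y) => //; split; exact: AB.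
Qed.

End Diameter.

Section Normalization.
Context {R : realType} {S : choiceType}.
Implicit Types (w : S -> R).

Definition normalize w : S -> R := fun s => w s / \sum_(t \in [set: S]) w t.

Lemma supp_normalize w : supp (normalize w) `<=` supp w.
Proof.
by move=> s; apply: contraNN => /eqP ws; rewrite /normalize ws mul0r.
Qed.

Lemma normalize_full_complex w : finite_set (supp w) -> (forall s, 0 <= w s) ->
  0 < \sum_(s \in [set: S]) w s -> full_complex (normalize w).
Proof.
move=> finw w0 W0; apply: full_complex_intro.
- exact: sub_finite_set (@supp_normalize w) _.
- by move=> s; rewrite divr_ge0// ltW.
- by rewrite /normalize -mulr_fsuml divff// gt_eqF.
Qed.

Lemma l1_dist_normalize (r : R) w w' : finite_set (supp w) ->
  finite_set (supp w') -> (forall s, 0 <= w' s) -> 0 < r ->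
  r <= \sum_(s \in [set: S]) w s -> r <= \sum_(s \in [set: S]) w' s ->
  l1_dist (normalize w) (normalize w') <= 2 / r * l1_dist w w'.
Proof.
move=> finw finw' w'0 r0 rw rw'; have := l1_dist_ge_sumT finw finw'.
rewrite /normalize; set W := \sum_(s \in _) w s in rw *.
set W' := \sum_(s \in _) w' s in rw' * => WW'.
have W0 : 0 < W by exact: lt_le_trans rw.
have W'0 : 0 < W' by exact: lt_le_trans rw'.
set D := supp w `|` supp w'.
have finD : finite_set D by rewrite finite_setU.
rewrite (@l1_distE _ _ D); last 2 first.
- by move=> s /supp_normalize ?; left.
- by move=> s /supp_normalize ?; right.
apply: (@le_trans _ _ (\sum_(s \in D) (W^-1 * `|w s - w' s| +
    W^-1 * `|W - W'| / W' * w' s))).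
  apply: ler_fsum => // s _.
  have -> : w s / W - w' s / W' =
      W^-1 * (w s - w' s) - W^-1 * (W - W') / W' * w' s.
    by field; rewrite !gt_eqF.
  apply: le_trans (ler_normB _ _) _; rewrite !normrM !normfV.
  by rewrite (gtr0_norm W0) (gtr0_norm W'0) (ger0_norm (w'0 s)).
rewrite fsumrD// -!mulr_fsumr -l1_distE; last 2 first.
- by left.
- by right.
rewrite -(@fsumTE _ _ D) => [|s Ds]; last first.
  by apply: notin_supp => ws; apply: Ds; right.
rewrite -/W' divfK ?gt_eqF// -mulrDr mulrAC mulrC.
apply: ler_pM; rewrite ?addr_ge0 ?invr_ge0 ?l1_dist_ge0 ?(ltW W0)//.
  by have := WW'; lra.
by rewrite lef_pV2.
Qed.

End Normalization.

Section Bump.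
Context {R : realType} {X : metricType R} (r : R).
Implicit Types (V : set X) (x y : X).

(** The value is [max 0 (r - distance from x to V)]; writing it as a supremum
    containing 0 also gives 0 for an empty [V]. *)
Definition bump V x : R := sup (0 |` [set r - mdist x y | y in V]).

Lemma has_sup_bump V x : has_sup (0 |` [set r - mdist x y | y in V]).
Proof.
split; first by exists 0; left.
exists (Num.max 0 r) => _ [->|[y _ <-]]; first by rewrite le_max lexx.
by rewrite le_max gerBl mdist_ge0 orbT.
Qed.

Lemma bump_ge0 V x : 0 <= bump V x.
Proof. by apply: (sup_upper_bound (has_sup_bump V x)); left. Qed.

Lemma bump_ge V x y : V y -> r - mdist x y <= bump V x.
Proof.
by move=> Vy; apply: (sup_upper_bound (has_sup_bump V x)); right; exists y.
Qed.

Lemma bump_lipschitz V x y : bump V x - bump V y <= mdist x y.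
Proof.
rewrite lerBlDr; apply: ge_sup; first by exists 0; left.
move=> _ [->|[z Vz <-]]; first by rewrite addr_ge0 ?mdist_ge0 ?bump_ge0.
have := bump_ge y Vz; have := metric_triangle y x z.
by rewrite (metric_sym y x); lra.
Qed.

Lemma bump_neq0 V x : bump V x != 0 -> exists2 y, V y & mdist x y < r.
Proof.
move=> bx; have {bx} : 0 < bump V x by rewrite lt0r bx bump_ge0.
move=> /sup_gt[|_ [->|[y Vy <-]]]; first by exists 0; left.
  by rewrite ltxx.
by rewrite subr_gt0; exists y.
Qed.

End Bump.

Lemma skeleton_intro (R : realType) (S : choiceType) (K : set (S -> R)) n h :
  full_complex h -> supp h #<= `I_n.+1 -> simplex (supp h) `<=` K ->
  skeleton n K h.
Proof.
move=> Dh hn hK; exists (supp h) => //; split => //.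
by have [s hs] := full_complex_pos Dh; exists s; exact: lt0r_neq0.
Qed.

Lemma vertices_skeleton (R : realType) (S : choiceType) (K : set (S -> R)) n v :
  simplex [set v] `<=` K -> vertices (skeleton n K) v.
Proof.
move=> vK; set e : S -> R := fun s => (s == v)%:R.
have ev : supp e `<=` [set v].
  by move=> s; rewrite /supp /e /=; case: (s =P v) => // _; rewrite eqxx.
have fine : finite_set (supp e) by exact: sub_finite_set ev _.
apply: skeleton_intro.
- apply: full_complex_intro => //.
  by rewrite (@fsumTE _ _ [set v]) ?fsbig_set1 /e ?eqxx// => s /eqP/negbTE ->.
- apply: card_le_trans (subset_card_le ev) _.
  by rewrite (card_le_eql card_set1) card_le_II.
- by apply: subset_trans vK => f [Df fe]; split=> //; apply: subset_trans ev.
Qed.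

(** Take a uniformly bounded cover such that every ball of radius [r] meets at
    most n + 1 of its elements, and normalize the bump functions
    [max 0 (r - distance to V)].  They are 1-Lipschitz, at most n + 1 of them
    are nonzero at a given point, and their sum is at least [r], so the
    normalized family is Lipschitz with a constant of order n / r; and any set
    of diameter less than [r] has all its points in the support of a common
    bump. *)
Lemma asdim_partition_of_unity (R : realType) (X : metricType R) (n : nat)
    (epsilon : R) : asdim_le X n -> 0 < epsilon ->
  exists p : X -> set X -> R,
    partition_of_unity epsilon (skeleton n full_complex) p.
Proof.
move=> Xn e0; set k : R := n.+1%:R.
have k1 : 1 <= k by rewrite ler1n.
(* The normalized bumps are 4 * k / r - Lipschitz. *)
set r : R := 4 * k / epsilon.
have r0 : 0 < r by rewrite divr_gt0//; lra.
have ballcover : is_cover (range (fun x : X => [set y | mdist x y < r])).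
  rewrite /is_cover; apply/seteqP; split=> // x _.
  exists [set y | mdist x y < r]; first by exists x.
  by rewrite /= mdistxx.
have ballbounded :
    uniformly_bounded (range (fun x : X => [set y | mdist x y < r])).
  exists (2 * r) => _ [x _ <-]; apply: diam_le => [|y z /= xy xz]; first lra.
  have := metric_triangle y x z; rewrite (metric_sym y x); lra.
have [VV [VVcover [M VVM] VVmult]] := Xn _ ballcover ballbounded.
pose w x V : R := if V \in VV then bump r V x else 0.
have w0 x V : 0 <= w x V by rewrite /w; case: ifP => // _; exact: bump_ge0.
have wsupp x V : supp (w x) V -> VV V /\ exists2 y, V y & mdist x y < r.
  rewrite /supp/= /w; case: ifPn; last by rewrite eqxx.
  by rewrite inE => VVV /bump_neq0.
have cardw x : supp (w x) #<= `I_n.+1.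
  apply: card_le_trans (VVmult [set y | mdist x y < r] _); last by exists x.
  apply: subset_card_le => V /wsupp[VVV [y Vy xy]]; split => //.
  by exists y.
have finw x : finite_set (supp (w x)) by apply/finite_set_leP; exists n.+1.
have wcover x : exists2 V, VV V & V x.
  have : [set: X] x by [].
  by rewrite -VVcover => -[V VVV Vx]; exists V.
have wge x y V : VV V -> V x -> r - mdist y x <= w y V.
  by move=> VVV Vx; rewrite /w mem_set//; exact: bump_ge.
have W x : r <= \sum_(V \in [set: set X]) w x V.
  have [V VVV Vx] := wcover x; have := wge _ x _ VVV Vx; rewrite mdistxx subr0.
  move=> rV; apply: (le_trans rV); rewrite (fsumTE (@notin_supp _ _ (w x))).
  have := @ler_fsum_subset _ _ [set V] _ (w x) (finw x); rewrite fsbig_set1.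
  by apply=> // _ ->; apply: lt0r_neq0; exact: lt_le_trans rV.
have W0 x : 0 < \sum_(V \in [set: set X]) w x V by exact: lt_le_trans (W x).
have w_l1 x y : l1_dist (w x) (w y) <= 2 * k * mdist x y.
  set D := supp (w x) `|` supp (w y).
  have finD : finite_set D by rewrite finite_setU.
  rewrite (@l1_distE _ _ D); [|by left|by right].
  set d := mdist x y; have d0 : 0 <= d by exact: mdist_ge0.
  apply: (@le_trans _ _ (\sum_(V \in D) ((if V \in supp (w x) then d else 0) +
      (if V \in supp (w y) then d else 0)))).
    apply: ler_fsum => // V DV.
    apply: (@le_trans _ _ d).
      rewrite /w; case: ifP => _; last by rewrite subrr normr0.
      rewrite ler_norml lerNl opprB bump_lipschitz andbT.
      by rewrite /d metric_sym bump_lipschitz.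
    by case: DV => DV; rewrite (mem_set DV) ?lerDl ?lerDr; case: ifP.
  rewrite fsumrD//.
  have := fsum_indic_le finD (cardw x) d0.
  by have := fsum_indic_le finD (cardw y) d0; rewrite -/k; lra.
pose p x := normalize (w x).
have Dp x : full_complex (p x) by exact: normalize_full_complex.
have ppos x V : 0 < w x V -> 0 < p x V by move=> ?; exact: divr_gt0.
have psupp x V : 0 < p x V -> VV V /\ exists2 y, V y & mdist x y < r.
  by move=> pxV; apply: wsupp; apply: supp_normalize; exact: lt0r_neq0.
have skp x : skeleton n full_complex (p x).
  apply: skeleton_intro => // [|_ []//].
  apply: card_le_trans (cardw x); apply: subset_card_le.
  exact: supp_normalize.
exists p; split=> //.
- move=> x y; apply: (@le_trans _ _ (epsilon * mdist x y)); last first.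
    by rewrite lerDl ltW.
  apply: le_trans (l1_dist_normalize (finw x) (finw y) (w0 y) r0 (W x) (W y)) _.
  have e2 : epsilon = 2 / r * (2 * k).
    by rewrite /r; field; rewrite !gt_eqF//; lra.
  by rewrite [in leRHS]e2 -[leRHS]mulrA ler_wpM2l// divr_ge0// ltW.
- exists (`|M| + 2 * r) => _ [V _ <-].
  apply: diam_le => [|x y [_ px] [_ py]].
    by rewrite addr_ge0// mulr_ge0// ltW.
  have [VVV [x' Vx' xx']] := psupp _ _ px.
  have [_ [y' Vy' yy']] := psupp _ _ py.
  have := le_trans (mdist_le_diam Vx' Vy') (VVM _ VVV); rewrite lee_fin => x'y'.
  have := metric_triangle x x' y; have := metric_triangle x' y' y.
  by rewrite (metric_sym y' y); have := ler_norm M; lra.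
- move=> B dB.
  have vV V : vertices (skeleton n full_complex) V.
    by apply: vertices_skeleton => f [].
  (* An empty B is contained in the element of any vertex. *)
  have [[x Bx]|B0] := pselect (B !=set0); last first.
    exists (p @^-1` star (skeleton n full_complex) set0); first by exists set0.
    by move=> x Bx; exfalso; apply: B0; exists x.
  have [V VVV Vx] := wcover x.
  exists (p @^-1` star (skeleton n full_complex) V); first by exists V.
  move=> y By; split=> //; apply: ppos; apply: lt_le_trans (wge _ y _ VVV Vx).
  have := le_lt_trans (mdist_le_diam By Bx) dB; rewrite lte_fin subr_gt0.
  move=> /lt_le_trans; apply; rewrite /r ler_pM2r ?invr_gt0//; lra.
Qed.

(** * Pushing partitions of unity into a skeleton *)

Section Filling.
Context {R : realType} {X : metricType R} {S : choiceType} (n : nat).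
Implicit Types (K : set (S -> R)) (f : X -> S -> R) (g : S -> R) (B : set X).

Lemma skeleton_full_complex (T : choiceType) (K : set (T -> R)) (g : T -> R) :
  skeleton n K g -> full_complex g /\ supp g #<= `I_n.+1.
Proof.
move=> [F [_ Fn _] [Dg gF]]; split=> //.
exact: card_le_trans (subset_card_le gF) Fn.
Qed.

Lemma simplicial_complex_simplex K g : is_simplicial_complex K -> K g ->
  full_complex g /\ simplex (supp g) `<=` K.
Proof.
move=> [FF [_ ->]] [F FFF [Dg gF]]; split=> // h [Dh hg].
by exists F => //; split=> //; exact: subset_trans gF.
Qed.

Lemma skeleton_sub K : skeleton n K `<=` K.
Proof. by move=> g [F [_ _ FK] /FK]. Qed.

Lemma simplex_vertex K g s : is_simplicial_complex K -> K g -> 0 < g s ->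
  simplex [set s] `<=` K.
Proof.
move=> Kcplx Kg gs; have [_ gK] := simplicial_complex_simplex Kcplx Kg.
apply: subset_trans gK => h [Dh hs]; split=> // t /hs ->.
exact: lt0r_neq0.
Qed.

(** A coordinate that exceeds the defect by the margin of [dominant_coord] at
    one point of [B] still exceeds it throughout [B], both varying by
    at most half the margin.  If there is no such point in [B], the second
    condition is vacuous and any vertex given by the Lebesgue number will do. *)
Lemma exists_dominant_vertex K f (delta M : R) B :
  is_simplicial_complex K -> partition_of_unity delta K f ->
  0 < delta -> 0 <= M -> M < 1 / delta ->
  2 * (delta * M + delta) <= (2 * n.+1%:R + 1)^-1 -> (diam B <= M%:E)%E ->
  exists v, forall x, B x -> 0 < f x v /\
    forall s, 2 * defect n.+1 (f x) < f x s -> defect n.+1 (f x) < f x v.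
Proof.
move=> Kcplx [fK flip _ fleb] d0 M0 Md dM BM.
have Df x : full_complex (f x).
  by have [] := simplicial_complex_simplex Kcplx (fK x I).
have near x y : B x -> B y -> l1_dist (f x) (f y) <= delta * M + delta.
  move=> Bx By; apply: le_trans (flip x y) _; rewrite lerD2r.
  rewrite ler_wpM2l ?(ltW d0)//.
  by rewrite -lee_fin; exact: le_trans (mdist_le_diam Bx By) BM.
have [[x0 Bx0 [v fv]]|noB] := pselect (exists2 x, B x & exists v,
    defect n.+1 (f x) + (2 * n.+1%:R + 1)^-1 < f x v).
  exists v => x Bx.
  have [[finx _ _] [finx0 _ _]] := (Df x, Df x0).
  have := l1_dist_ge_coord v finx0 finx.
  have := defect_lipschitz n.+1 (Df x0) (Df x).
  have l := near _ _ Bx0 Bx.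
  rewrite !ler_norml => /andP[? ?] /andP[? ?].
  have dx : defect n.+1 (f x) < f x v by lra.
  by split=> // ; exact: le_lt_trans (defect_ge0 _ (Df x)) dx.
have [_ [v _ <-] Bv] : exists2 V, star_cover K f V & B `<=` V.
  by apply: fleb; apply: le_lt_trans BM _; rewrite lte_fin.
exists v => x Bx; split=> [|s fs]; first by have [] := Bv _ Bx.
by exfalso; apply: noB; exists x => //; exact: (dominant_coord (Df x) fs).
Qed.

(** The blend of the trimmed [f] with the image of [p] under [v]: the condition
    on [v] makes both parts share their at most n + 1 vertices wherever the
    trimmed [f] is nonzero. *)
Lemma filling (epsilon delta : R) K (A : set X) f (T : choiceType)
    (p : X -> T -> R) (v : T -> S) :
  0 < epsilon -> 0 < delta -> 4 * (4 * n.+1%:R + 1) * delta <= epsilon ->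
  is_simplicial_complex K -> partition_of_unity delta K f ->
  (forall x, A x -> skeleton n K (f x)) ->
  partition_of_unity (epsilon / 2) (skeleton n full_complex) p ->
  (forall t x, 0 < p x t -> 0 < f x (v t) /\
    forall s, 2 * defect n.+1 (f x) < f x s ->
      defect n.+1 (f x) < f x (v t)) ->
  exists2 h : X -> S -> R,
    partition_of_unity epsilon (skeleton n K) h & filler K A f f h.
Proof.
move=> e0 d0 de Kcplx [fK flip [M fM] fleb] fA [psk plip _ pleb] vP.
have Kf x := simplicial_complex_simplex Kcplx (fK x I).
have Df x : full_complex (f x) by have [] := Kf x.
have f0 x s : 0 <= f x s by have [_ /(_ s)/andP[]] := Df x.
have Dp x : full_complex (p x) by have [] := skeleton_full_complex (psk x I).
have pgt0 x t : supp (p x) t -> 0 < p x t.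
  by move=> pt; rewrite lt0r pt; have [_ /(_ t)/andP[]] := Dp x.
pose q x := trim n.+1 (f x).
pose psi x := simplicial_map v (p x).
have Dpsi x : full_complex (psi x) by exact: simplicial_map_full_complex.
have finq x : finite_set (supp (q x)).
  by apply: sub_finite_set (supp_trim_sub (Df x)) _; have [] := Df x.
have q0 x s : 0 <= q x s by exact: trim_ge0.
have q1 x : \sum_(s \in [set: S]) q x s <= 1 by exact: sum_trim_le1.
pose h x := blend (q x) (psi x).
have Dh x : full_complex (h x) by exact: blend_full_complex.
have suppsi x : supp (psi x) `<=` supp (f x).
  move=> s /supp_simplicial_map[t /pgt0 pt <-].
  by apply: lt0r_neq0; have [] := vP _ _ pt.
have supph x : supp (h x) `<=` supp (f x).
  by move=> s /supp_blend[/(supp_trim_sub (Df x))|/suppsi].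
(* Where q x is nonzero the supports of q x and psi x lie in the set of
   coordinates above the defect; elsewhere only psi x contributes. *)
have cardh x : supp (h x) #<= `I_n.+1.
  have [[s qs]|noq] := pselect (supp (q x) !=set0).
    apply: card_le_trans (card_gt_defect n.+1 (Df x)).
    apply: subset_card_le => s' /supp_blend[/supp_trim/=|].
      by apply: le_lt_trans; have := defect_ge0 n.+1 (Df x); lra.
    move=> /supp_simplicial_map[t /pgt0 pt <-].
    by have [_ /(_ s)] := vP _ _ pt; apply; exact: supp_trim qs.
  have [_ pn] := skeleton_full_complex (psk x I).
  apply: card_le_trans pn; apply: card_le_trans (card_image_le v _).
  apply: subset_card_le => s /supp_blend[qs|/supp_simplicial_map//].
  by exfalso; apply: noq; exists s.
have hf x : defect n.+1 (f x) = 0 -> h x = f x.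
  move=> c0; apply/funext => s; rewrite /h /blend /q trim_id//.
  by have [_ _ ->] := Df x; rewrite subrr mul0r addr0.
have hpos x s : 0 < h x s -> 0 < f x s.
  move=> hs; rewrite lt0r f0 andbT.
  by apply: (supph x); exact: lt0r_neq0.
have hsk x : skeleton n K (h x).
  apply: skeleton_intro => //.
  apply: subset_trans (proj2 (Kf x)) => g [Dg gh]; split=> //.
  exact: subset_trans gh (supph x).
exists h; last first.
  split=> [x Ax|x _ [F [_ _ -> _]] /= [_ fF]].
    apply: hf; have [_ fn] := skeleton_full_complex (fA x Ax).
    exact: defect_skeleton.
  by split=> //; exact: subset_trans fF.
split.
- by move=> x _; exact: hsk.
- move=> x y.
  have := l1_dist_blend (finq x) (finq y) (q0 x) (q1 x) (Dpsi x) (Dpsi y).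
  have [[finpx _ _] [finpy _ _]] := (Dp x, Dp y).
  have := l1_dist_simplicial_map v finpx finpy; have := plip x y.
  have := l1_dist_trim n.+1 (Df x) (Df y).
  have := flip x y; have := mdist_ge0 x y.
  rewrite -/(q x) -/(q y) -/(psi x) -/(psi y) -/(h x) -/(h y).
  set d := mdist x y => d0' lf lq lp lpsi lh.
  have k0 : 0 <= 4 * n.+1%:R + 1 :> R by rewrite addr_ge0// mulr_ge0.
  have : (4 * n.+1%:R + 1) * l1_dist (f x) (f y) <=
      (4 * n.+1%:R + 1) * (delta * d + delta) by exact: ler_wpM2l.
  have : 4 * (4 * n.+1%:R + 1) * delta * (d + 1) <= epsilon * (d + 1).
    by rewrite ler_wpM2r// addr_ge0.
  by move: (4 * n.+1%:R + 1) => c in k0 de lq *; nra.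
- exists M => _ [s sK <-].
  apply: le_trans (fM (f @^-1` star K s) _).
    by apply: diam_subset => x [_ /hpos fx]; split; first exact: fK.
  by exists s => //; exact: skeleton_sub sK.
- move=> B dB.
  (* An empty B only asks for a vertex, which the star cover of f provides. *)
  have [[x Bx]|B0] := pselect (B !=set0); last first.
    have [|_ [s sK _] _] := fleb set0.
      by apply: le_lt_trans (diam_le (lexx 0) _) _; rewrite ?lte_fin ?divr_gt0.
    exists (h @^-1` star (skeleton n K) s).
      exists s => //; apply: vertices_skeleton (simplex_vertex Kcplx sK _).
      by rewrite eqxx.
    by move=> x Bx; exfalso; apply: B0; exists x.
  have [_ [t _ <-] Bt] :
      exists2 V, star_cover (skeleton n full_complex) p V & B `<=` V.
    apply: pleb; apply: lt_le_trans dB _.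
    rewrite lee_fin !div1r invf_div -[leLHS]mul1r.
    rewrite ler_wpM2r ?invr_ge0 ?(ltW e0)//.
    by lra.
  exists (h @^-1` star (skeleton n K) (v t)).
    exists (v t) => //; have [_ pt] := Bt x Bx; have [fv _] := vP _ _ pt.
    exact: vertices_skeleton (simplex_vertex Kcplx (fK x I) fv).
  move=> y /Bt[_ pt]; split; first exact: hsk.
  (* If q y carries the whole mass, psi y disappears from h y, but then h y is
     f y, which is positive at v t as well. *)
  have [q1'|q1'] := eqVneq (\sum_(s \in [set: S]) q y s) 1.
    rewrite hf; last exact: sum_trim_eq1 q1'.
    by have [] := vP _ _ pt.
  have {}q1' : \sum_(s \in [set: S]) q y s < 1 by rewrite lt_neqAle q1' q1.
  rewrite /h /blend ltr_wpDl// mulr_gt0 ?subr_gt0//.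
  exact: simplicial_map_gt0.
Qed.

End Filling.

(** * Extension to the whole space *)

Theorem corollary4p4 (R : realType) (X : metricType R) (n : nat) :
  asdim_le X n ->
  forall epsilon : R, 0 < epsilon ->
  exists2 delta : R, 0 < delta &
  forall (S : choiceType) (K : set (S -> R)) (A : set X) (f g : X -> S -> R),
    is_simplicial_complex K ->
    partition_of_unity delta K f ->
    set_fun A (skeleton n K) g ->
    (forall x, A x -> f x = g x) ->
  exists2 h : X -> S -> R,
    partition_of_unity epsilon (skeleton n K) h & filler K A f g h.
Proof.
move=> Xn e e0; have e2 : 0 < e / 2 by rewrite divr_gt0.
have [p pP] := asdim_partition_of_unity Xn e2.
have [_ _ [M0 pM] _] := pP.
pose M := `|M0|; have M_ge0 : 0 <= M by exact: normr_ge0.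
pose k : R := n.+1%:R; have k_ge0 : 0 <= k by [].
(* The three summands of D = 1 / delta are respectively for the Lebesgue number
   of f to exceed M, for f and its defect to vary by less than the margin on
   sets of diameter M, and for the Lipschitz constant of the trimmed f. *)
pose D := (M + 1) + 2 * (M + 1) * (2 * k + 1) + 4 * (4 * k + 1) / e.
have t1 : 0 <= 2 * (M + 1) * (2 * k + 1).
  by rewrite !mulr_ge0 ?addr_ge0// mulr_ge0.
have t2 : 0 <= 4 * (4 * k + 1) / e.
  by rewrite divr_ge0 ?(ltW e0)// mulr_ge0// addr_ge0// mulr_ge0.
have D0 : 0 < D by rewrite /D; lra.
exists D^-1; first by rewrite invr_gt0.
move=> S K A f g Kcplx fP gA fg.
have d0 : 0 < D^-1 by rewrite invr_gt0.
have : forall V : set X, exists v, forall x, 0 < p x V -> 0 < f x v /\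
    forall s, 2 * defect n.+1 (f x) < f x s -> defect n.+1 (f x) < f x v.
  move=> V.
  have [] := @exists_dominant_vertex _ _ _ n K f D^-1 M [set x | 0 < p x V]
    Kcplx fP d0 M_ge0.
  - by rewrite div1r invrK /D; lra.
  - have -> : 2 * (D^-1 * M + D^-1) = (2 * (M + 1)) / D by ring.
    rewrite -/k ler_pdivrMr// [leRHS]mulrC ler_pdivlMr.
      by rewrite /D; lra.
    by rewrite ltr_wpDl// mulr_ge0.
  - apply: le_trans
      (le_trans (pM (p @^-1` star (skeleton n full_complex) V) _) _).
    + apply: diam_subset => x px; split => //.
      by have [psk _ _ _] := pP; exact: psk.
    + by exists V => //; apply: vertices_skeleton => ? [].
    + by rewrite lee_fin ler_norm.
  - by move=> v vP; exists v.
move=> /choice[v vP].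
have [h hP [hA hD]] : exists2 h : X -> S -> R,
    partition_of_unity e (skeleton n K) h & filler K A f f h.
  apply: (filling (delta := D^-1) (v := v) e0 d0 _ Kcplx fP _ pP).
  - rewrite -/k ler_pdivrMr// [leRHS]mulrC -ler_pdivrMr// /D; lra.
  - by move=> x Ax; rewrite fg//; exact: gA.
  - by move=> t x; exact: vP.
by exists h => //; split=> // x Ax; rewrite hA// fg.
Qed.
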